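(* Let $p$ be any odd prime. Then the following matrices $A,B,C,D$ in $SL(2,\mathbb{F}_p(x,y))$ generate a faithful representation of the genus 2 surface group, where we have $ABA^{-1}B^{-1}=DCD^{-1}C^{-1}$: \[A=\begin{pmatrix} \frac{1-2x^2-2x^3}{x(x-1)}&\frac{1-2x^2-x^3-x^4}{x^3(x-1)}\\ 1&\frac{1}{x^2}\end{pmatrix},\qquad B=\begin{pmatrix} \frac{x^2-1}{x-2x^3-2x^4}&\frac{1+2x-x^2-3x^3-2x^4}{x^2(2x^3+2x^2-1)}\\ x&1+x\end{pmatrix},\] \[D=\begin{pmatrix} \frac{1-2x^2-2x^3}{x(x-1)}&\frac{1-2x^2-x^3-x^4}{yx^3(x-1)}\\ y&\frac{1}{x^2}\end{pmatrix},\qquad C=\begin{pmatrix} \frac{x^2-1}{x-2x^3-2x^4}&\frac{1+2x-x^2-3x^3-2x^4}{yx^2(2x^3+2x^2-1)}\\ yx&1+x\end{pmatrix}.\] That is, the assignment $a\mapsto A$, $b\mapsto B$, $c\mapsto C$, $d\mapsto D$ defines an injective homomorphism from $S_2=\langle a,b,c,d\mid aba^{-1}b^{-1}=dcd^{-1}c^{-1}\rangle$ to $SL(2,\mathbb{F}_p(x,y))$.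
   Context: $S_2$ denotes the fundamental group of the closed orientable surface of genus 2, with presentation $\langle a,b,c,d\mid aba^{-1}b^{-1}=dcd^{-1}c^{-1}\rangle$. $\mathbb{F}_p(x,y)$ is the field of rational functions over the field with $p$ elements in two algebraically independent variables $x,y$. *)

(* Defs.v *)
From HB Require Import structures.
From mathcomp Require Import all_boot all_order all_algebra.
From mathcomp Require Import boolp.

Set Implicit Arguments.
Unset Strict Implicit.
Unset Printing Implicit Defensive.

Import GRing.Theory.
Local Open Scope ring_scope.
Local Open Scope quotient_scope.

(* A word over X; the letter (x, true) stands for x and (x, false) for x^-1. *)
Notation word X := (seq (X * bool)).

Section PresentedGroup.
Variables (X : choiceType) (rels : seq (word X * word X)).

(* Words up to free reduction and the relations l = r for (l, r) \in rels. *)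
Inductive pres_eq : word X -> word X -> Prop :=
| pres_refl u : pres_eq u u
| pres_sym u v : pres_eq u v -> pres_eq v u
| pres_trans u v w : pres_eq u v -> pres_eq v w -> pres_eq u w
| pres_cancel u x e v : pres_eq (u ++ [:: (x, e); (x, ~~ e)] ++ v) (u ++ v)
| pres_rel u l r v :
    (l, r) \in rels -> pres_eq (u ++ l ++ v) (u ++ r ++ v).

Lemma pres_eq_cat u u' v v' :
  pres_eq u u' -> pres_eq v v' -> pres_eq (u ++ v) (u' ++ v').
Proof.
move=> uu' vv'; apply: (@pres_trans _ (u' ++ v)).
  elim: uu' v {v' vv'} => [||||].
  - by move=> *; apply: pres_refl.
  - by move=> ? ? _ IH v; apply: pres_sym; apply: IH.
  - by move=> ? ? ? _ IH1 _ IH2 v; apply: pres_trans (IH1 v) (IH2 v).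
  - by move=> ? x e w v; rewrite -!catA; apply: pres_cancel.
  - by move=> ? l r w lr v; rewrite -!catA; apply: pres_rel.
elim: vv' u' {u uu'} => [||||].
- by move=> *; apply: pres_refl.
- by move=> ? ? _ IH u; apply: pres_sym; apply: IH.
- by move=> ? ? ? _ IH1 _ IH2 u; apply: pres_trans (IH1 u) (IH2 u).
- by move=> w x e w' u; rewrite !(catA u w); apply: pres_cancel.
- by move=> w l r w' lr u; rewrite !(catA u w); apply: pres_rel.
Qed.

Definition inv_letter (s : X * bool) := (s.1, ~~ s.2).
Definition inv_word (u : word X) : word X := rev (map inv_letter u).

Lemma inv_wordK : involutive inv_word.
Proof.
move=> u; rewrite /inv_word map_rev revK -map_comp -[RHS]map_id.
by apply: eq_map => -[x e]; rewrite /inv_letter /= negbK.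
Qed.

Lemma inv_word_cat u v : inv_word (u ++ v) = inv_word v ++ inv_word u.
Proof. by rewrite /inv_word map_cat rev_cat. Qed.

Lemma pres_eq_catV u : pres_eq (u ++ inv_word u) [::].
Proof.
elim: u => [|[x e] u IH]; first exact: pres_refl.
rewrite -cat1s inv_word_cat -catA (catA u).
apply: pres_trans (@pres_cancel [::] x e [::]).
apply: pres_eq_cat (pres_refl _) _.
exact: pres_eq_cat IH (pres_refl _).
Qed.

Lemma pres_eq_catVl u : pres_eq (inv_word u ++ u) [::].
Proof. by rewrite -{2}(inv_wordK u); apply: pres_eq_catV. Qed.

Lemma pres_eq_inv u v : pres_eq u v -> pres_eq (inv_word u) (inv_word v).
Proof.
move=> uv; apply: (@pres_trans _ (inv_word u ++ (v ++ inv_word v))).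
  rewrite -[X in pres_eq X _]cats0; apply: pres_eq_cat (pres_refl _) _.
  exact/pres_sym/pres_eq_catV.
rewrite catA -[X in pres_eq _ X]cat0s; apply: pres_eq_cat (pres_refl _).
apply: pres_trans (pres_eq_catVl u); apply: pres_eq_cat (pres_refl _) _.
exact: pres_sym.
Qed.

Definition pres_eqb (u v : word X) : bool := `[< pres_eq u v >].

Lemma pres_eqb_refl : reflexive pres_eqb.
Proof. by move=> u; apply/asboolP/pres_refl. Qed.

Lemma pres_eqb_sym : symmetric pres_eqb.
Proof. by move=> u v; apply/asboolP/asboolP => /pres_sym. Qed.

Lemma pres_eqb_trans : transitive pres_eqb.
Proof.
by move=> v u w /asboolP uv /asboolP vw; apply/asboolP/(pres_trans uv vw).
Qed.

Canonical pres_equiv := EquivRel pres_eqb pres_eqb_refl pres_eqb_sym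
  pres_eqb_trans.

Definition presented := {eq_quot pres_equiv}.
HB.instance Definition _ := Choice.on presented.
HB.instance Definition _ := EqQuotient.on presented.

Definition pres_class (u : word X) : presented := \pi_presented u.
Definition pres_gen (x : X) : presented := pres_class [:: (x, true)].

Lemma pres_classP u v : pres_class u = pres_class v <-> pres_eq u v.
Proof.
by split=> [/eqmodP/asboolP // | uv]; apply/eqmodP/asboolP.
Qed.

Lemma pres_reprK (g : presented) : pres_class (repr g) = g.
Proof. exact: reprK. Qed.

Definition pres_one : presented := pres_class [::].
Definition pres_mul (g h : presented) := pres_class (repr g ++ repr h).
Definition pres_inv (g : presented) := pres_class (inv_word (repr g)).

Lemma pres_class_cat u v :
  pres_class (u ++ v) = pres_mul (pres_class u) (pres_class v).
Proof.
by apply/pres_classP/pres_eq_cat; apply/pres_classP; rewrite pres_reprK.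
Qed.

Lemma pres_class_inv u : pres_class (inv_word u) = pres_inv (pres_class u).
Proof. by apply/pres_classP/pres_eq_inv/pres_classP; rewrite pres_reprK. Qed.

Lemma pres_mulA : associative pres_mul.
Proof.
move=> f g h; rewrite -(pres_reprK f) -(pres_reprK g) -(pres_reprK h).
by rewrite -!pres_class_cat catA.
Qed.

Lemma pres_mul1 : left_id pres_one pres_mul.
Proof. by move=> g; rewrite -(pres_reprK g) -pres_class_cat. Qed.

Lemma pres_muls1 : right_id pres_one pres_mul.
Proof. by move=> g; rewrite -(pres_reprK g) -pres_class_cat cats0. Qed.

Lemma pres_mulV : left_inverse pres_one pres_inv pres_mul.
Proof.
move=> g; rewrite -(pres_reprK g) -pres_class_inv -pres_class_cat.
exact/pres_classP/pres_eq_catVl.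
Qed.

Lemma pres_mulsV : right_inverse pres_one pres_inv pres_mul.
Proof.
move=> g; rewrite -(pres_reprK g) -pres_class_inv -pres_class_cat.
exact/pres_classP/pres_eq_catV.
Qed.

HB.instance Definition _ := isGroup.Build presented
  pres_mulA pres_mul1 pres_muls1 pres_mulV pres_mulsV.

End PresentedGroup.

Definition gen_a : 'I_4 := @Ordinal 4 0 isT.
Definition gen_b : 'I_4 := @Ordinal 4 1 isT.
Definition gen_c : 'I_4 := @Ordinal 4 2 isT.
Definition gen_d : 'I_4 := @Ordinal 4 3 isT.

Definition comm_word (s t : 'I_4) : word 'I_4 :=
  [:: (s, true); (t, true); (s, false); (t, false)].

Definition S2_rels : seq (word 'I_4 * word 'I_4) :=
  [:: (comm_word gen_a gen_b, comm_word gen_d gen_c)].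

Notation S2 := (presented S2_rels).

Section SpecialLinear.
Variables (n : nat) (R : comUnitRingType).

Record SL := MkSL { slval :> 'M[R]_n; _ : \det slval == 1 }.

HB.instance Definition _ := [isSub for slval].
HB.instance Definition _ := [Choice of SL by <:].

Lemma det_SL (M : SL) : \det M = 1.
Proof. by case: M => M /= /eqP. Qed.

Lemma SL_unitmx (M : SL) : (M : 'M_n) \in unitmx.
Proof. by rewrite unitmxE det_SL unitr1. Qed.

Fact SL_one_subproof : \det (1%:M : 'M[R]_n) == 1.
Proof. by rewrite det1. Qed.
Fact SL_mul_subproof (M N : SL) : \det (M *m N) == 1.
Proof. by rewrite det_mulmx !det_SL mulr1. Qed.
Fact SL_inv_subproof (M : SL) : \det (invmx M) == 1.
Proof. by rewrite det_inv det_SL invr1. Qed.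

Definition SL_one := MkSL SL_one_subproof.
Definition SL_mul (M N : SL) := MkSL (SL_mul_subproof M N).
Definition SL_inv (M : SL) := MkSL (SL_inv_subproof M).

Lemma SL_mulA : associative SL_mul.
Proof. by move=> M N P; apply: val_inj; apply: mulmxA. Qed.
Lemma SL_mul1 : left_id SL_one SL_mul.
Proof. by move=> M; apply: val_inj; apply: mul1mx. Qed.
Lemma SL_muls1 : right_id SL_one SL_mul.
Proof. by move=> M; apply: val_inj; apply: mulmx1. Qed.
Lemma SL_mulV : left_inverse SL_one SL_inv SL_mul.
Proof. by move=> M; apply: val_inj; apply/mulVmx/SL_unitmx. Qed.
Lemma SL_mulsV : right_inverse SL_one SL_inv SL_mul.
Proof. by move=> M; apply: val_inj; apply/mulmxV/SL_unitmx. Qed.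

HB.instance Definition _ := isGroup.Build SL
  SL_mulA SL_mul1 SL_muls1 SL_mulV SL_mulsV.

End SpecialLinear.

Definition mx2 (K : Type) (m00 m01 m10 m11 : K) : 'M[K]_2 :=
  \matrix_(i, j) if i == 0 then (if j == 0 then m00 else m01)
                 else (if j == 0 then m10 else m11).

(* F_p(x, y) as the fraction field of F_p[x][y]: the inner variable is x and
   the outer one is y; 'F_p is the field with p elements when p is prime. *)
Notation Fpxy p := {fraction {poly {poly 'F_p}}}.

Definition var_x (p : nat) : Fpxy p :=
  FracField.tofrac ('X : {poly 'F_p})%:P.
Definition var_y (p : nat) : Fpxy p :=
  FracField.tofrac ('X : {poly {poly 'F_p}}).

Section Matrices.
Variable p : nat.
Let x : Fpxy p := var_x p.
Let y : Fpxy p := var_y p.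

Definition matA : 'M[Fpxy p]_2 := mx2
  ((1 - 2 * x ^+ 2 - 2 * x ^+ 3) / (x * (x - 1)))
  ((1 - 2 * x ^+ 2 - x ^+ 3 - x ^+ 4) / (x ^+ 3 * (x - 1)))
  1
  (1 / x ^+ 2).

Definition matB : 'M[Fpxy p]_2 := mx2
  ((x ^+ 2 - 1) / (x - 2 * x ^+ 3 - 2 * x ^+ 4))
  ((1 + 2 * x - x ^+ 2 - 3 * x ^+ 3 - 2 * x ^+ 4)
     / (x ^+ 2 * (2 * x ^+ 3 + 2 * x ^+ 2 - 1)))
  x
  (1 + x).

Definition matD : 'M[Fpxy p]_2 := mx2
  ((1 - 2 * x ^+ 2 - 2 * x ^+ 3) / (x * (x - 1)))
  ((1 - 2 * x ^+ 2 - x ^+ 3 - x ^+ 4) / (y * x ^+ 3 * (x - 1)))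
  y
  (1 / x ^+ 2).

Definition matC : 'M[Fpxy p]_2 := mx2
  ((x ^+ 2 - 1) / (x - 2 * x ^+ 3 - 2 * x ^+ 4))
  ((1 + 2 * x - x ^+ 2 - 3 * x ^+ 3 - 2 * x ^+ 4)
     / (y * x ^+ 2 * (2 * x ^+ 3 + 2 * x ^+ 2 - 1)))
  (y * x)
  (1 + x).

End Matrices.

(* Main.v *)
(* Let [T = diag(1, y)]. Then [D = T A T^-1] and [C = T B T^-1], while the
   commutator [aba^-1b^-1] is sent to a diagonal matrix, which commutes with
   [T]; this gives the relation. Two facts give injectivity.

   1. For the valuation of [F_p(x)] at infinity, [A] and [B] play ping-pong on
   the projective line (this needs [2 != 0]), so they generate a free group.
   Both ends fixed by the commutator, [0] and infinity, are coded by periodic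
   itineraries, and comparing itineraries shows that their stabilizers are
   generated by the commutator: every other element of [<A, B>] has nonzero
   off-diagonal entries.

   2. [S_2] is the amalgam of [<a, b>] and [<d, c>] along the commutator. In an
   alternating product of elements outside of the amalgamated subgroup, the
   nonzero off-diagonal entries make the degree in [y] grow, so that the
   product is not a scalar matrix. *)

Require Import Defs.
From HB Require Import structures.
From mathcomp Require Import all_boot all_order all_algebra.
From mathcomp Require Import ring zify.

Set Implicit Arguments.
Unset Strict Implicit.
Unset Printing Implicit Defensive.

Import GRing.Theory.
Local Open Scope ring_scope.

(** * Words and two-by-two matrices *)

Section Words.
Variables (X : choiceType).
Implicit Types (u v w : word X).

Lemma pres_eq_catl (rels : seq (word X * word X)) u v w :
  pres_eq rels v w -> pres_eq rels (u ++ v) (u ++ w).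
Proof. by apply: pres_eq_cat; apply: pres_refl. Qed.

Lemma pres_eq_catr (rels : seq (word X * word X)) u v w :
  pres_eq rels u v -> pres_eq rels (u ++ w) (v ++ w).
Proof. by move=> uv; apply: pres_eq_cat uv _; apply: pres_refl. Qed.

Lemma inv_letterK : involutive (@inv_letter X).
Proof. by case=> x e; rewrite /inv_letter /= negbK. Qed.

Definition reduced w := sorted (fun s t => t != inv_letter s) w.

Definition rename (Y : choiceType) (f : X -> Y) w : word Y :=
  [seq (f s.1, s.2) | s <- w].

Lemma rename_inv (Y : choiceType) (f : X -> Y) w :
  rename f (inv_word w) = inv_word (rename f w).
Proof. by rewrite /rename /inv_word map_rev -!map_comp. Qed.

Lemma pres_eq_rename (Y : choiceType) (rels : seq (word Y * word Y))
    (f : X -> Y) u v :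
  pres_eq [::] u v -> pres_eq rels (rename f u) (rename f v).
Proof.
elim=> {u v} [u|u v _ uv|u v w _ uv _ vw|u x e v|//].
- exact: pres_refl.
- exact: pres_sym.
- exact: pres_trans uv vw.
- by rewrite /rename !map_cat; apply: pres_cancel.
Qed.

End Words.

(** * Homomorphisms out of a presented group *)

Section WordEvaluation.
Variables (X : choiceType) (G : groupType) (f : X -> G).
Local Open Scope group_scope.

Definition word_eval (w : word X) : G :=
  foldr (fun s g => (if s.2 then f s.1 else (f s.1)^-1) * g) 1 w.

Lemma word_eval_cat u v : word_eval (u ++ v) = word_eval u * word_eval v.
Proof. by elim: u => [|s u IH] /=; rewrite ?mul1g // IH mulgA. Qed.

Lemma word_eval_pres (rels : seq (word X * word X)) u v :
    {in rels, forall r, word_eval r.1 = word_eval r.2} ->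
  pres_eq rels u v -> word_eval u = word_eval v.
Proof.
move=> relsP; elim=> {u v} [//|//|u v w _ -> _ -> //|u x e v|u l r v lr].
- rewrite !word_eval_cat /= mulg1; congr (_ * _).
  by case: e => /=; rewrite ?mulgV ?mulVg mul1g.
- by rewrite !word_eval_cat (relsP _ lr).
Qed.

(** The universal property of a presentation: evaluation is constant on classes once it respects the
    relations, so evaluating a representative is a morphism. *)
Lemma pres_lift (rels : seq (word X * word X)) :
    {in rels, forall r, word_eval r.1 = word_eval r.2} ->
  exists rho : {multiplicative presented rels -> G},
    forall u, rho (pres_class rels u) = word_eval u.
Proof.
move=> relsP; pose rho (g : presented rels) := word_eval (repr g).
have rhoE u : rho (pres_class rels u) = word_eval u.
  by apply: word_eval_pres relsP _; apply/pres_classP; rewrite pres_reprK.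
have rhoM : {morph rho : g h / g * h}.
  by move=> g h; rewrite [LHS]rhoE word_eval_cat.
pose mixin := isMultiplicative.Build _ _ rho rhoM.
pose rhoMor : {multiplicative presented rels -> G} := HB.pack rho mixin.
by exists rhoMor.
Qed.

End WordEvaluation.

(** * Two-by-two matrices up to scalars *)

Section TwoByTwo.
Variable R : comNzRingType.
Implicit Types (M N : 'M[R]_2) (v w : R * R).

(** The adjugate replaces the inverse, which need not exist over a polynomial ring; the two differ
    by the determinant, so words are evaluated up to a scalar. *)
Definition adj2 M : 'M[R]_2 := mx2 (M 1 1) (- M 0 1) (- M 1 0) (M 0 0).

Definition app M v : R * R :=
  (M 0 0 * v.1 + M 0 1 * v.2, M 1 0 * v.1 + M 1 1 * v.2).

(** Over a domain, this vanishes on nonzero vectors exactly when they represent the same point of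
    the projective line. *)
Definition cross v w : R := v.1 * w.2 - v.2 * w.1.

Definition scale2 (a : R) v : R * R := (a * v.1, a * v.2).

Lemma mx2P M N :
    M 0 0 = N 0 0 -> M 0 1 = N 0 1 -> M 1 0 = N 1 0 -> M 1 1 = N 1 1 ->
  M = N.
Proof.
move=> e00 e01 e10 e11; apply/matrixP => i j.
have tw (k : 'I_2) : k = 0 \/ k = 1.
  by case: k => -[|[|//]] ?; [left | right]; apply: val_inj.
by case: (tw i) => ->; case: (tw j) => ->.
Qed.

Lemma mulmx2E M N i j : (M *m N) i j = M i 0 * N 0 j + M i 1 * N 1 j.
Proof.
rewrite mxE big_ord_recl big_ord1; congr (_ * _ + M i _ * N _ j);
  exact: val_inj.
Qed.

Lemma det_mx2 M : \det M = M 0 0 * M 1 1 - M 0 1 * M 1 0.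
Proof.
rewrite (expand_det_row _ 0) big_ord_recl big_ord1 /cofactor !det_mx11 !mxE.
rewrite /= expr0 expr1 mul1r mulN1r mulrN.
by congr (_ * M _ _ - M _ _ * M _ _); apply: val_inj.
Qed.

Lemma mul_adj2 M : M *m adj2 M = (\det M)%:M.
Proof. by rewrite det_mx2; apply: mx2P; rewrite mulmx2E !mxE /=; ring. Qed.

Lemma det_adj2 M : \det (adj2 M) = \det M.
Proof. by rewrite !det_mx2 !mxE /=; ring. Qed.

Lemma adj2K M : adj2 (adj2 M) = M.
Proof. by apply: mx2P; rewrite !mxE /= ?opprK. Qed.

Lemma app_mul M N v : app (M *m N) v = app M (app N v).
Proof. by rewrite /app !mulmx2E /=; congr pair; ring. Qed.

Lemma app1 v : app 1%:M v = v.
Proof. by case: v => v1 v2; rewrite /app !mxE /=; congr pair; ring. Qed.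

Lemma app_scale M a v : app M (scale2 a v) = scale2 a (app M v).
Proof. by rewrite /app /scale2 /=; congr pair; ring. Qed.

Lemma appZ M a v : app (a *: M) v = scale2 a (app M v).
Proof. by rewrite /app /scale2 !mxE /=; congr pair; ring. Qed.

Lemma cross_app M v w : cross (app M v) w = cross v (app (adj2 M) w).
Proof. by rewrite /cross /app !mxE /=; ring. Qed.

Lemma cross_scaler a v w : cross v (scale2 a w) = a * cross v w.
Proof. by rewrite /cross /scale2 /=; ring. Qed.

Section WordMatrix.
Variables (X : choiceType) (m : X -> 'M[R]_2).

Definition letter_mx (s : X * bool) := if s.2 then m s.1 else adj2 (m s.1).
Definition word_mx (w : word X) := foldr (fun s N => letter_mx s *m N) 1%:M w.

Lemma word_mx_cat (u1 u2 : word X) :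
  word_mx (u1 ++ u2) = word_mx u1 *m word_mx u2.
Proof. by elim: u1 => [|s u IH] /=; rewrite ?mul1mx // IH mulmxA. Qed.

Lemma letter_mx_inv s : letter_mx (inv_letter s) = adj2 (letter_mx s).
Proof. by case: s => x [] //; rewrite /letter_mx /= adj2K. Qed.

End WordMatrix.
End TwoByTwo.

Section WordMatrixIdomain.
Variables (R : idomainType) (X : choiceType) (m : X -> 'M[R]_2).
Hypothesis m_det : forall x, \det (m x) != 0.

Lemma word_mx_det w : \det (word_mx m w) != 0.
Proof.
elim: w => [|[x e] w IH] /=; first by rewrite det1 oner_eq0.
by rewrite det_mulmx mulf_neq0 //; case: e; rewrite /letter_mx /= ?det_adj2.
Qed.

(** Cancelling a letter against its inverse divides the matrix by a nonzero determinant, since a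
    matrix times its adjugate is scalar. *)
Lemma reduced_form w : exists r, [/\ reduced r, pres_eq [::] w r &
  exists2 d, d != 0 & word_mx m w = d *: word_mx m r].
Proof.
elim: w => [|s w [r [rr wr [d d0 wm]]]].
  by exists [::]; split=> //; [apply: pres_refl | exists 1;
    rewrite ?oner_eq0 ?scale1r].
case: r rr wr wm => [|t r] rr wr wm.
  exists [:: s]; split=> //; first exact: (pres_eq_catl [:: s] wr).
  by exists d; rewrite //= wm scalemxAr.
have [ts|ts] := eqVneq t (inv_letter s); last first.
  exists [:: s, t & r]; split; first by rewrite /reduced /= ts.
    exact: (pres_eq_catl [:: s] wr).
  by exists d => //; rewrite [LHS]/= wm -scalemxAr.
exists r; split; first exact: path_sorted rr.
  apply: pres_trans (pres_eq_catl [:: s] wr) _; rewrite ts.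
  by case: (s) => x e; apply: (pres_cancel _ [::]).
exists (d * \det (letter_mx m s)).
  by rewrite mulf_neq0 //; case: (s) => x []; rewrite /letter_mx /= ?det_adj2.
rewrite /= wm /= ts letter_mx_inv -scalemxAr mulmxA mul_adj2 mul_scalar_mx.
by rewrite scalerA.
Qed.

End WordMatrixIdomain.

(** * Ping-pong at infinity *)

Lemma size_mul_ltn (D : idomainType) (a u w : {poly D}) :
  a != 0 -> (size (a * u)%R < size (a * w)%R)%N = (size u < size w)%N.
Proof.
move=> a0; have [->|w0] := eqVneq w 0; first by rewrite mulr0 size_poly0.
have [->|u0] := eqVneq u 0.
  by rewrite mulr0 size_poly0 !size_poly_gt0 mulf_neq0 ?w0.
rewrite !size_mul //; move: a0; rewrite -size_poly_gt0.
by case: (size a) => // n _; rewrite !addSn /= ltn_add2l.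
Qed.

Section DegreePingPong.
Variable F : fieldType.
Local Notation R := {poly F}.
Implicit Types (v : R * R) (s t : bool * bool).

(** The ultrametric rule for the absolute value at infinity: a dominant term fixes the degree of a
    sum. *)
Lemma size_lead (c r t : R) k :
    size c = 1%N -> r != 0 -> (size t < k + size r)%N ->
  size (c * 'X^k * r + t) = (k + size r)%N.
Proof.
move=> c1 r0 tr; have c0 : c != 0 by rewrite -size_poly_gt0 c1.
have cX0 : c * 'X^k != 0 by rewrite mulf_neq0 // -size_poly_gt0 size_polyXn.
have e : size (c * 'X^k * r) = (k + size r)%N.
  by rewrite size_mul // (size_mul c0) -?size_poly_gt0 size_polyXn // c1.
by rewrite size_polyDl e.
Qed.

Lemma size_comb (q1 q2 v1 v2 : R) k1 k2 n :
    (size q1 <= k1.+1)%N -> (size q2 <= k2.+1)%N ->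
    (k1 + size v1 <= n)%N -> (k2 + size v2 <= n)%N ->
  (size (q1 * v1 + q2 * v2)%R <= n)%N.
Proof.
move=> q1k q2k n1 n2; apply: leq_trans (size_polyD _ _) _.
by rewrite geq_max; apply/andP; split; apply: leq_trans (size_polyMleq _ _) _;
  lia.
Qed.

Lemma size_add_leq n (p q : R) :
  (size p <= n)%N -> (size q <= n)%N -> (size (p + q)%R <= n)%N.
Proof. by move=> pn qn; rewrite (leq_trans (size_polyD _ _)) // geq_max pn. Qed.

Lemma size_sub_leq n (p q : R) :
  (size p <= n)%N -> (size q <= n)%N -> (size (p - q)%R <= n)%N.
Proof. by move=> pn qn; rewrite size_add_leq ?size_polyN. Qed.

Lemma size_natXn_leq n m k : (k < n)%N -> (size (m%:R * 'X^k : R)%R <= n)%N.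
Proof.
move=> kn; rewrite mulr_natl -scaler_nat (leq_trans (size_scale_leq _ _)) //.
by rewrite size_polyXn.
Qed.

Lemma size_Xn_leq n k : (k < n)%N -> (size ('X^k : R)%R <= n)%N.
Proof. by rewrite size_polyXn. Qed.

Lemma size_two : (2 : F) != 0 -> size (2 : R) = 1%N.
Proof. by move=> two_neq0; rewrite -polyC_natr size_polyC two_neq0. Qed.

End DegreePingPong.

(* The coefficient type of a polynomial occurs in two convertible forms, which
   [lia] would treat as distinct. *)
Ltac size_lia :=
  repeat match goal with H : ?P |- _ =>
    lazymatch P with is_true (leq _ _) => revert H | _ => clear H end end;
  repeat match goal with |- context [@size (GRing.Field.sort ?K) ?s] =>
    change (@size (GRing.Field.sort K) s)
      with (@size (GRing.NzSemiRing.sort K) s) end;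
  intros; lia.

Ltac size_tac :=
  repeat first [ apply: size_add_leq | apply: size_sub_leq
               | rewrite size_polyN ];
  solve [ exact: size_Xn_leq | exact: size_natXn_leq
        | exact: (@size_natXn_leq _ _ _ 1) | by rewrite size_poly1
        | by rewrite size_polyX | by rewrite size_poly0].

(** * The four discs of the ping-pong and the itineraries of the fixed ends *)

Section Generators.
Variable F : fieldType.
Hypothesis two_neq0 : (2 : F) != 0.
Local Notation R := {poly F}.
Implicit Types (v : R * R) (s t : bool * bool).

(* [A] and [B] cleared of denominators: [mxA = x^3 (x - 1) A] and
   [mxB = x^2 (2 x^3 + 2 x^2 - 1) B]. *)
Definition mxA : 'M[R]_2 := mx2
  ('X^2 * (1 - 2 * 'X^2 - 2 * 'X^3)) (1 - 2 * 'X^2 - 'X^3 - 'X^4)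
  ('X^3 * ('X - 1)) ('X * ('X - 1)).
Definition mxB : 'M[R]_2 := mx2
  (- 'X * ('X^2 - 1)) (1 + 2 * 'X - 'X^2 - 3 * 'X^3 - 2 * 'X^4)
  ('X^3 * (2 * 'X^3 + 2 * 'X^2 - 1))
  ('X^2 * (1 + 'X) * (2 * 'X^3 + 2 * 'X^2 - 1)).

Definition mxAB (x : bool) := if x then mxA else mxB.

(** In terms of the point [z = v.1 / v.2] and the absolute value at infinity, these are open discs
    around infinity, [-1/(2x)], [0] and [-1], attracting for [A], [A^-1], [B] and [B^-1]
    respectively. Comparing sizes avoids fractions, and strictness excludes the zero vector. *)
Definition dom s v : bool :=
  match s with
  | (true, true) => (size v.2 < size v.1)%N
  | (true, false) => (size (2 * 'X * v.1 + v.2)%R < size v.2)%N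
  | (false, true) => (size ('X * v.1)%R < size v.2)%N
  | (false, false) => (size (v.1 + v.2)%R < size v.1)%N
  end.

(** Outside the disc of the inverse letter, some form in [v] ([r], [v2] or [v1] below) has
    controlled size; it carries the leading term of one coordinate of the image, and the quantity
    compared with that coordinate in [dom] has lower degree. *)
Lemma pingpong s v :
  v != 0 -> ~~ dom (inv_letter s) v -> dom s (app (letter_mx mxAB s) v).
Proof.
case: s v => [[] []] [v1 v2] v0 /=; rewrite -leqNgt /app /letter_mx /=
  !mxE /= ?mxE /=.
- have [r rE] : exists r, r = 2 * 'X * v1 + v2 by exists (2 * 'X * v1 + v2).
  rewrite -rE => h.
  have r0 : r != 0.
    apply: contraNneq v0 => r0; move: h; rewrite r0 size_poly0 leqn0.
    rewrite size_poly_eq0 => /eqP v20; move/eqP: r0.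
    rewrite rE v20 addr0 !mulf_eq0 polyX_eq0 orbF -size_poly_eq0 size_two //=.
    by move=> /eqP->.
  have h1 : (size v1 < size r)%N.
    have [->|v10] := eqVneq v1 0; first by rewrite size_poly0 size_poly_gt0.
    have <- : size (2 * 'X * v1) = (size v1).+1.
      have := @size_lead F 2 v1 0 1 (size_two two_neq0) v10.
      by rewrite addr0 size_poly0 add1n; apply.
    have -> : 2 * 'X * v1 = r - v2 by rewrite rE; ring.
    exact: size_sub_leq.
  have -> : 'X^2 * (1 - 2 * 'X^2 - 2 * 'X^3) * v1 +
      (1 - 2 * 'X^2 - 'X^3 - 'X^4) * v2 = -1 * 'X^4 * r +
      (('X^2 - 2 * 'X^4) * v1 + (1 - 2 * 'X^2 - 'X^3) * v2) by rewrite rE; ring.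
  have hl : (size (('X^2 - 2 * 'X^4) * v1 + (1 - 2 * 'X^2 - 'X^3) * v2)%R
     <= 3 + size r)%N.
    by apply: (@size_comb _ _ _ _ _ 4 3); [size_tac|size_tac|size_lia|size_lia].
  rewrite (@size_lead _ (-1) r _ 4) //; last first.
    by rewrite size_polyN size_poly1.
  rewrite addSn ltnS.
  have -> : 'X^3 * ('X - 1) * v1 + 'X * ('X - 1) * v2 =
     ('X^4 - 'X^3) * v1 + ('X^2 - 'X) * v2 by ring.
  by apply: (@size_comb _ _ _ _ _ 4 2); [size_tac|size_tac|size_lia|size_lia].
- move=> h.
  have v20 : v2 != 0.
    apply: contraNneq v0 => v20; move: h.
    by rewrite v20 size_poly0 leqn0 size_poly_eq0 => /eqP->.
  have -> : - ('X^3 * ('X - 1)) * v1 +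
      'X^2 * (1 - 2 * 'X^2 - 2 * 'X^3) * v2 = -2 * 'X^5 * v2 +
      (('X^3 - 'X^4) * v1 + ('X^2 - 2 * 'X^4) * v2) by ring.
  have hl : (size (('X^3 - 'X^4) * v1 + ('X^2 - 2 * 'X^4) * v2)%R
     <= 4 + size v2)%N.
    by apply: (@size_comb _ _ _ _ _ 4 4); [size_tac|size_tac|size_lia|size_lia].
  rewrite (@size_lead _ (-2) v2 _ 5) //; last first.
    by rewrite size_polyN size_two.
  rewrite addSn ltnS; set u := (X in (size (polyseq X) <= _)%N).
  (* The terms of degree 5 and 4 in the coefficient of [v2] cancel: this is what the centre
     [-1/(2x)] is chosen for. *)
  have -> : u = ((- 'X^4 + 3 * 'X^3 - 2 * 'X^2) * v1 +
     ('X^2 + 4 * 'X^3 - 2 * 'X) * v2) by rewrite /u; ring.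
  by apply: (@size_comb _ _ _ _ _ 4 3); [size_tac|size_tac|size_lia|size_lia].
- have [r rE] : exists r, r = v1 + v2 by exists (v1 + v2).
  rewrite -rE => h.
  have h2 : (size v2 <= size r)%N.
    have -> : v2 = r - v1 by rewrite rE; ring.
    exact: size_sub_leq.
  have r0 : r != 0.
    apply: contraNneq v0 => r0; move: h h2.
    by rewrite r0 size_poly0 !leqn0 !size_poly_eq0 => /eqP-> /eqP->.
  have -> : 'X^3 * (2 * 'X^3 + 2 * 'X^2 - 1) * v1 +
      'X^2 * (1 + 'X) * (2 * 'X^3 + 2 * 'X^2 - 1) * v2 = 2 * 'X^6 * r +
      ((2 * 'X^5 - 'X^3) * r + (2 * 'X^5 + 2 * 'X^4 - 'X^2) * v2).
    by rewrite rE; ring.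
  rewrite size_lead ?size_two //; last first.
    rewrite addSn ltnS.
    by apply: (@size_comb _ _ _ _ _ 5 5); [size_tac|size_tac|size_lia|size_lia].
  rewrite addSn ltnS; set u := (X in (size (polyseq X) <= _)%N).
  have -> : u = ('X^2 - 'X^4) * v1 +
     ('X + 2 * 'X^2 - 'X^3 - 3 * 'X^4 - 2 * 'X^5) * v2 by rewrite /u; ring.
  by apply: (@size_comb _ _ _ _ _ 4 5); [size_tac|size_tac|size_lia|size_lia].
- move=> h.
  have v10 : v1 != 0.
    apply: contraNneq v0 => v10; move: h.
    by rewrite v10 mulr0 size_poly0 leqn0 size_poly_eq0 => /eqP->.
  have {}h : (size v2 <= (size v1).+1)%N.
    by move: h; rewrite mulrC size_mulX.
  have -> : 'X^2 * (1 + 'X) * (2 * 'X^3 + 2 * 'X^2 - 1) * v1 +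
      - (1 + 2 * 'X - 'X^2 - 3 * 'X^3 - 2 * 'X^4) * v2 = 2 * 'X^6 * v1 +
      ((4 * 'X^5 + 2 * 'X^4 - 'X^3 - 'X^2) * v1 +
       ('X^2 + 3 * 'X^3 + 2 * 'X^4 - 2 * 'X - 1) * v2) by ring.
  have hl : (size ((4 * 'X^5 + 2 * 'X^4 - 'X^3 - 'X^2) * v1 +
       ('X^2 + 3 * 'X^3 + 2 * 'X^4 - 2 * 'X - 1) * v2)%R <= 5 + size v1)%N.
    by apply: (@size_comb _ _ _ _ _ 5 4); [size_tac|size_tac|size_lia|size_lia].
  rewrite size_lead ?size_two //.
  rewrite addSn ltnS; set u := (X in (size (polyseq X) <= _)%N).
  (* The terms in ['X^6] cancel, which reflects the centre [-1]. *)
  have -> : u = (2 * 'X^5 + 2 * 'X^4 - 'X^2) * v1 +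
     (2 * 'X^4 + 2 * 'X^3 + 'X^2 - 'X - 1) * v2 by rewrite /u; ring.
  by apply: (@size_comb _ _ _ _ _ 5 4); [size_tac|size_tac|size_lia|size_lia].
Qed.

Lemma dom_neq0 s v : dom s v -> v != 0.
Proof.
by apply: contraTneq => ->; case: s => [[] []] /=;
  rewrite ?mulr0 ?addr0 size_poly0.
Qed.

Lemma size_mul2X (v1 : R) : v1 != 0 -> size (2 * 'X * v1) = (size v1).+1.
Proof.
move=> v10; have := @size_lead F 2 v1 0 1 (size_two two_neq0) v10.
by rewrite addr0 size_poly0 add1n; apply.
Qed.

(** The four discs are pairwise disjoint. *)
Lemma dom_inj s t v : dom s v -> dom t v -> s = t.
Proof.
have XE (u : R) : u != 0 -> size ('X * u) = (size u).+1.
  by move=> u0; rewrite mulrC size_mulX.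
(* This claim and the next assume only [|z| >= 1], so that they serve for the discs of both [A] and
   [B^-1]. *)
have aa' (u : R * R) : (size u.2 <= size u.1)%N -> dom (true, false) u -> False.
  case: u => u1 u2 /= le12; have [u10|u10] := eqVneq u1 0.
    by move: le12; rewrite u10 size_poly0 leqn0 => /eqP->.
  by rewrite size_polyDl size_mul2X //; size_lia.
have ab (u : R * R) : (size u.2 <= size u.1)%N -> dom (false, true) u -> False.
  case: u => u1 u2 /= le12; have [u10|u10] := eqVneq u1 0.
    by move: le12; rewrite u10 size_poly0 leqn0 => /eqP->.
  by rewrite XE //; size_lia.
have ab' (u : R * R) : dom (true, true) u -> dom (false, false) u -> False.
  by case: u => u1 u2 /= lt21; rewrite size_polyDl // ltnn.
have a'b (u : R * R) : dom (true, false) u -> dom (false, true) u -> False.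
  case: u => u1 u2 /= + lt12; rewrite addrC size_polyDl ?ltnn //.
  have [->|u10] := eqVneq u1 0.
    by rewrite mulr0 size_poly0; apply: leq_ltn_trans lt12.
  by move: lt12; rewrite size_mul2X // XE.
have b' (u : R * R) : dom (false, false) u -> (size u.2 <= size u.1)%N.
  case: u => u1 u2 /= lt; have -> : u2 = (u1 + u2) - u1 by ring.
  by apply: size_sub_leq => //; apply: ltnW.
(* The weight [2 s.1 + s.2] orders the letters, so that each unordered pair is treated once. *)
wlog st : s t / (s.1 + s.1 + s.2 <= t.1 + t.1 + t.2)%N.
  by move=> H ds dt; case: (leqP (s.1 + s.1 + s.2) (t.1 + t.1 + t.2)) =>
    [/H|/ltnW/H] => [|<-]; auto.
case: s t st => [[] []] [[] []] //= _ d1 d2; exfalso.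
- exact: aa' (ltnW d2) d1.
- exact: ab (ltnW d2) d1.
- exact: a'b d2 d1.
- exact: ab' d2 d1.
- exact: aa' (b' _ d1) d2.
- exact: ab (b' _ d1) d2.
Qed.

(** In a reduced word, the disc reached by each letter is disjoint from the one that the letter to
    its left must avoid. *)
Lemma pingpong_word s w v :
    reduced (s :: w) -> v != 0 -> ~~ dom (inv_letter (last s w)) v ->
  dom s (app (word_mx mxAB (s :: w)) v).
Proof.
elim: w s => [|t w IH] s; first by rewrite /= mulmx1; move=> _; apply: pingpong.
move=> /= /andP[ts tw] v0 nd; have dt := IH t tw v0 nd.
rewrite app_mul; apply: pingpong (dom_neq0 dt) _.
by apply: contra ts => ds; rewrite (dom_inj dt ds).
Qed.

Lemma dom_scale s (a : R) v : a != 0 -> dom s (scale2 a v) = dom s v.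
Proof.
move=> a0; case: s v => [[] []] [v1 v2] /=.
- by rewrite size_mul_ltn.
- have -> : 2 * 'X * (a * v1) + a * v2 = a * (2 * 'X * v1 + v2) by ring.
  by rewrite size_mul_ltn.
- by rewrite mulrCA size_mul_ltn.
- by rewrite -mulrDr size_mul_ltn.
Qed.

(** The vectors are proportional: multiplying [w] by a nonzero coordinate of [v] gives a multiple of
    [v], and the discs ignore scaling. *)
Lemma cross_dom s v w : cross v w = 0 -> w != 0 -> dom s v -> dom s w.
Proof.
case: v w => [v1 v2] [w1 w2] /eqP; rewrite /cross subr_eq0 => /eqP /= e w0 dv.
have v0 := dom_neq0 dv.
have [v10|v10] := eqVneq v1 0; last first.
  rewrite -(dom_scale _ _ v10) /scale2 /= e mulrC [v2 * _]mulrC.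
  rewrite -/(scale2 w1 (v1, v2)) dom_scale //.
  apply: contraNneq w0 => w10; move/eqP: e.
  by rewrite w10 mulr0 mulf_eq0 (negPf v10) => /eqP->.
have v20 : v2 != 0 by apply: contraNneq v0 => v20; rewrite v10 v20.
rewrite -(dom_scale _ _ v20) /scale2 /= -e mulrC [v2 * _]mulrC.
rewrite -/(scale2 w2 (v1, v2)) dom_scale //.
apply: contraNneq w0 => w20; move/eqP: e.
by rewrite w20 mulr0 eq_sym mulf_eq0 (negPf v20) => /eqP->.
Qed.

(* [Z] stands for any predicate that holds on the subgroup generated by the
   commutator. *)
Section Stabilizer.
Variable Z : word bool -> Prop.
Hypothesis Z_eq : forall u w, pres_eq [::] u w -> Z u -> Z w.
Hypothesis Z_cat : forall u w, Z u -> Z w -> Z (u ++ w).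
Hypothesis Z_inv : forall u, Z u -> Z (inv_word u).

(* The ends [pt s] form a cycle in which [pt s] is moved to [pt (nxt s)] by
   the inverse of the only letter [s] whose domain contains it, and [pre s] is
   a word leading from [pt s] to a base point, up to [Z]. A reduced word that
   maps an end of the cycle to another one can only follow the cycle: either
   its last letter cancels or ping-pong determines its first letter. *)
Lemma cycle_word (pt : bool * bool -> R * R) (nxt : bool * bool -> bool * bool)
    (pre : bool * bool -> word bool) :
    (forall s, dom s (pt s)) ->
    (forall s, exists2 mu, mu != 0 &
       app (letter_mx mxAB (inv_letter s)) (pt s) = scale2 mu (pt (nxt s))) ->
    (forall s, exists2 z, Z z &
       pres_eq [::] (pre s ++ [:: s]) (z ++ pre (nxt s))) ->
    Z [::] ->
  forall r s t, reduced r -> cross (app (word_mx mxAB r) (pt s)) (pt t) = 0 ->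
  Z (pre t ++ r ++ inv_word (pre s)).
Proof.
move=> domP nxtP preP Z0 r; have [n] := ubnP (size r).
elim: n r => // n IH r rn s t rr crt.
case: r => [|s0 r1] in rn rr crt *.
  have -> : t = s.
    apply: (@dom_inj _ _ (pt t)) => //.
    move: crt; rewrite [word_mx _ _]/= app1 => crt.
    exact: cross_dom crt (dom_neq0 (domP t)) (domP s).
  by apply: Z_eq Z0; apply/pres_sym/pres_eq_catV.
have [ls|ls] := eqVneq (last s0 r1) (inv_letter s).
  have e : s0 :: r1 = belast s0 r1 ++ [:: inv_letter s].
    by rewrite lastI -cats1 ls.
  move: rn rr crt; rewrite e size_cat addn1 ltnS /reduced cats1 => rn rr.
  rewrite -cats1 word_mx_cat app_mul [word_mx _ [:: _]]/= mulmx1.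
  have [mu mu0 ->] := nxtP s; rewrite app_scale.
  have -> u : cross (scale2 mu u) (pt t) = mu * cross u (pt t).
    by rewrite /cross /scale2 /=; ring.
  move/eqP; rewrite mulf_eq0 (negPf mu0) /= => /eqP crt.
  have rr' : reduced (belast s0 r1).
    by move: rr; rewrite -cats1 => /cat_sorted2[].
  have [z Zz ez] := preP s.
  apply: (@Z_eq ((pre t ++ belast s0 r1 ++ inv_word (pre (nxt s)))
                 ++ inv_word z));
    last by apply: Z_cat; [apply: IH | apply: Z_inv].
  rewrite -!catA; do 2!apply: pres_eq_catl.
  rewrite -inv_word_cat -[[:: inv_letter s]]/(inv_word [:: s]) -inv_word_cat.
  exact/pres_eq_inv/pres_sym.
have s0t : s0 = t.
  apply: (@dom_inj _ _ (pt t)) => //.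
  apply: cross_dom crt _ _; first exact: dom_neq0 (domP t).
  apply: pingpong_word rr (dom_neq0 (domP s)) _.
  apply: contra ls => dl; rewrite -(dom_inj dl (domP s)).
  by rewrite inv_letterK.
have [z Zz ez] := preP t.
apply: (@Z_eq (z ++ (pre (nxt t) ++ r1 ++ inv_word (pre s)))).
  rewrite s0t -cat1s !catA; do 2!apply: pres_eq_catr; exact: pres_sym.
apply: Z_cat => //; apply: IH => //; first exact: path_sorted rr.
(* The first letter passes to the other side of the cross product as its adjugate, which moves
   [pt t] one step along the cycle. *)
move: crt; rewrite [word_mx _ _]/= s0t app_mul cross_app -letter_mx_inv.
have [mu mu0 ->] := nxtP t; rewrite cross_scaler => /eqP.
by rewrite mulf_eq0 (negPf mu0) => /eqP.
Qed.

Hypothesis Z_comm :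
  Z [:: (true, true); (false, true); (true, false); (false, false)].

Lemma polyX_subr1_neq0 : 'X - 1 != 0 :> R.
Proof. by rewrite -polyC1 polyXsubC_eq0. Qed.

Lemma polyX_neq0 : 'X != 0 :> R.
Proof. by rewrite polyX_eq0. Qed.

Lemma pole_neq0 : 2 * 'X^3 + 2 * 'X^2 - 1 != 0 :> R.
Proof.
rewrite -size_poly_gt0 -addrA -[2 * 'X^3]mulr1.
rewrite size_lead ?size_two ?oner_neq0 //.
by rewrite size_poly1 ltnS; size_tac.
Qed.

Let neq0 := (polyX_neq0, polyX_subr1_neq0, pole_neq0, oppr_eq0, mulf_neq0,
  expf_neq0, oner_neq0).

(* For both ends fixed by [aba^-1b^-1]: the successive images of the end under
   the inverses of the letters of the period, up to scalars. *)
Lemma fix_infty w : reduced w -> word_mx mxAB w 1 0 = 0 -> Z w.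
Proof.
move=> rw w10.
pose pt s : R * R := match s with
  | (true, true) => (1, 0)
  | (false, true) => (1, - 'X^2)
  | (true, false) => ('X^2 + 'X + 1, - 'X^2 * (2 * 'X + 1))
  | (false, false) => (- ('X + 1), 'X)
  end.
pose nxt (s : bool * bool) := match s with
  | (true, true) => (false, true)
  | (false, true) => (true, false)
  | (true, false) => (false, false)
  | (false, false) => (true, true)
  end.
pose pre (s : bool * bool) : word bool := match s with
  | (true, true) => [::]
  | (false, true) => [:: (true, true)]
  | (true, false) => [:: (true, true); (false, true)]
  | (false, false) => [:: (true, true); (false, true); (true, false)]
  end.
have Z0 : Z [::] by apply: Z_eq (Z_cat Z_comm (Z_inv Z_comm));
  apply: pres_eq_catV.
have := @cycle_word pt nxt pre _ _ _ Z0 w (true, true) (true, true) rw.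
rewrite /= cats0; apply.
- case=> [[] []] /=.
  + by rewrite size_poly0 size_poly1.
  + have -> : 2 * 'X * ('X^2 + 'X + 1) + - 'X^2 * (2 * 'X + 1) =
      'X^2 + 2 * 'X :> R by ring.
    have -> : - 'X^2 * (2 * 'X + 1) = 2 * 'X^3 * -1 + - 'X^2 :> R by ring.
    rewrite size_lead ?size_two ?neq0 ?size_polyN ?size_poly1 ?size_polyXn //.
    by rewrite addn1 ltnS; size_tac.
  + by rewrite mulr1 size_polyN size_polyX size_polyXn.
  + have -> : - ('X + 1) + 'X = - 1 :> R by ring.
    by rewrite !size_polyN size_poly1 size_XaddC.
- case=> [[] []]; rewrite /app /scale2 /letter_mx /= !mxE /= ?mxE /=.
  + exists ('X * ('X - 1)); first by rewrite !neq0.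
    by congr pair; ring.
  + exists ('X^3 * ('X - 1) ^+ 2); first by rewrite !neq0.
    by congr pair; ring.
  + exists ('X^3); first by rewrite !neq0.
    by congr pair; ring.
  + exists (- ('X^2 * (2 * 'X^3 + 2 * 'X^2 - 1))); first by rewrite !neq0.
    by congr pair; ring.
- case=> [[] []] /=; try by exists [::] => //; apply: pres_refl.
  (* Only the last letter of the period closes the cycle; the element of [Z] gained there is the
     commutator. *)
  by exists [:: (true, true); (false, true); (true, false); (false, false)]
    => //; apply: pres_refl.
- by rewrite /cross /app /= w10; ring.
Qed.

(** A vanishing upper right entry means that the end [0] is fixed. Its period [bab^-1a^-1] spells
    the inverse of the commutator. *)
Lemma fix_zero w : reduced w -> word_mx mxAB w 0 1 = 0 -> Z w.
Proof.
move=> rw w01.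
pose pt s : R * R := match s with
  | (false, true) => (0, 1)
  | (true, true) =>
      (1 + 2 * 'X - 'X^2 - 3 * 'X^3 - 2 * 'X^4, 'X^3 - 'X)
  | (false, false) => (1 + 'X + 'X^4, - 'X^2 * (1 + 'X + 'X^2))
  | (true, false) => (- (1 - 2 * 'X^2 - 'X^3 - 'X^4),
      'X^2 * (1 - 2 * 'X^2 - 2 * 'X^3))
  end.
pose nxt (s : bool * bool) := match s with
  | (false, true) => (true, true)
  | (true, true) => (false, false)
  | (false, false) => (true, false)
  | (true, false) => (false, true)
  end.
pose pre (s : bool * bool) : word bool := match s with
  | (false, true) => [::]
  | (true, true) => [:: (false, true)]
  | (false, false) => [:: (false, true); (true, true)]
  | (true, false) => [:: (false, true); (true, true); (false, false)]
  end.
have Z0 : Z [::] by apply: Z_eq (Z_cat Z_comm (Z_inv Z_comm));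
  apply: pres_eq_catV.
have := @cycle_word pt nxt pre _ _ _ Z0 w (false, true) (false, true) rw.
rewrite /= cats0; apply.
- case=> [[] []] /=.
  + have -> : 1 + 2 * 'X - 'X^2 - 3 * 'X^3 - 2 * 'X^4 =
      2 * 'X^4 * -1 + (1 + 2 * 'X - 'X^2 - 3 * 'X^3) :> R by ring.
    rewrite size_lead ?size_two ?neq0 ?size_polyN ?size_poly1 //.
      by rewrite addn1 ltnS; size_tac.
    by rewrite addn1 ltnS; size_tac.
  + have -> : 2 * 'X * - (1 - 2 * 'X^2 - 'X^3 - 'X^4) +
      'X^2 * (1 - 2 * 'X^2 - 2 * 'X^3) =
      'X^2 + 4 * 'X^3 - 2 * 'X :> R by ring.
    have -> : 'X^2 * (1 - 2 * 'X^2 - 2 * 'X^3) =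
      2 * 'X^5 * -1 + ('X^2 - 2 * 'X^4) :> R by ring.
    rewrite size_lead ?size_two ?neq0 ?size_polyN ?size_poly1 //.
      by rewrite addn1 ltnS; size_tac.
    by rewrite addn1 ltnS; size_tac.
  + by rewrite mulr0 size_poly0 size_poly1.
  + have -> : 1 + 'X + 'X^4 + - 'X^2 * (1 + 'X + 'X^2) =
      1 + 'X - 'X^2 - 'X^3 :> R by ring.
    have -> : 1 + 'X + 'X^4 = 1 * 'X^4 * 1 + (1 + 'X) :> R by ring.
    rewrite size_lead ?neq0 ?size_poly1 //.
      by rewrite addn1 ltnS; size_tac.
    by rewrite addn1 ltnS; size_tac.
- case=> [[] []]; rewrite /app /scale2 /letter_mx /= !mxE /= ?mxE /=.
  + exists ('X^2 * ('X - 1)); first by rewrite !neq0.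
    by congr pair; ring.
  + exists ('X^6 * ('X - 1) ^+ 2); first by rewrite !neq0.
    by congr pair; ring.
  + exists (- 1); first by rewrite !neq0.
    by congr pair; ring.
  + exists ('X * (2 * 'X^3 + 2 * 'X^2 - 1)); first by rewrite !neq0.
    by congr pair; ring.
- case=> [[] []] /=; try by exists [::] => //; apply: pres_refl.
  exists (inv_word [:: (true, true); (false, true); (true, false);
    (false, false)]); first exact: Z_inv.
  exact: pres_refl.
- by rewrite /cross /app /= w01; ring.
Qed.

End Stabilizer.

(** The point [z = 1] lies outside all four discs, while a nonempty reduced word moves it into one
    of them and a scalar matrix would fix it. *)
Lemma reduced_scalar w c : reduced w -> word_mx mxAB w = c%:M -> w = [::].
Proof.
case: w => // s w rw wc; have two1 : size (2 : R) = 1%N by apply: size_two.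
have ndom t : ~~ dom t (1, 1).
  case: t => [[] []] /=.
  - by rewrite ltnn.
  - have := size_mul2X (oner_neq0 R); rewrite mulr1 => e.
    by rewrite size_polyDl e !size_poly1.
  - by rewrite mulr1 size_polyX size_poly1.
  (* Here [2 != 0] separates [1] from the centre [-1]. *)
  - by rewrite -[1 + 1]/(2 : R) two1 size_poly1.
have v0 : (1, 1) != 0 :> R * R by rewrite xpair_eqE oner_eq0.
have := pingpong_word rw v0 (ndom _).
have -> : app (word_mx mxAB (s :: w)) (1, 1) = scale2 c (1, 1).
  by rewrite wc -scalemx1 appZ app1.
have [->|c0] := eqVneq c 0; last by rewrite dom_scale // (negPf (ndom _)).
by move=> /dom_neq0; rewrite /scale2 !mul0r eqxx.
Qed.

(** As [A] and [B] have determinant 1, the determinant is the square of the factor that cleared the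
    denominators. *)
Lemma mxAB_det x : \det (mxAB x) != 0.
Proof.
have ab : (if x then 'X^3 * ('X - 1) : R
  else 'X^2 * (2 * 'X^3 + 2 * 'X^2 - 1)) != 0.
  by case: x; rewrite !(mulf_neq0, expf_neq0, polyX_neq0, polyX_subr1_neq0,
    pole_neq0).
rewrite det_mx2; case: x ab => ab; rewrite !mxE /=.
- rewrite [X in X != 0](_ : _ = ('X^3 * ('X - 1)) ^+ 2); last by ring.
  by rewrite expf_neq0.
- rewrite [X in X != 0](_ : _ = ('X^2 * (2 * 'X^3 + 2 * 'X^2 - 1)) ^+ 2);
    last by ring.
  by rewrite expf_neq0.
Qed.

Lemma letter_offdiag s :
  letter_mx mxAB s 1 0 != 0.
Proof.
have ab : (if s.1 then 'X^3 * ('X - 1) : R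
  else 'X^3 * (2 * 'X^3 + 2 * 'X^2 - 1)) != 0.
  by case: (s.1); rewrite !(mulf_neq0, expf_neq0, polyX_neq0, polyX_subr1_neq0,
    pole_neq0).
by case: s ab => [[] []] ab; rewrite /letter_mx /= !mxE /= ?oppr_eq0 ?mxE.
Qed.

End Generators.

(** * The amalgam *)

(** The two factors are copies of one free group. With [d] paired with [a] and [c] with [b], the
    relation of [S_2] identifies the commutator with its own copy. *)
Definition emb1 (x : bool) : 'I_4 := if x then gen_a else gen_b.
Definition emb2 (x : bool) : 'I_4 := if x then gen_d else gen_c.

Section Double.
Variables (D : idomainType) (m : bool -> 'M[D]_2).
Hypothesis m_det : forall x, \det (m x) != 0.
Local Notation S := {poly D}.
Implicit Types (v q : S * S).

(* [y T M T^-1] for [T = diag(1, y)], with [y = 'X]. *)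
Definition twist (M : 'M[D]_2) : 'M[S]_2 :=
  mx2 ('X * (M 0 0)%:P) (M 0 1)%:P ('X^2 * (M 1 0)%:P) ('X * (M 1 1)%:P).

Definition double_mx (i : 'I_4) : 'M[S]_2 :=
  match val i with
  | 0 => map_mx polyC (m true)
  | 1 => map_mx polyC (m false)
  | 2 => twist (m false)
  | _ => twist (m true)
  end.

Lemma word_mx_emb1 w :
  word_mx double_mx (rename emb1 w) = map_mx polyC (word_mx m w).
Proof.
elim: w => [|[x e] w IH] /=; first by rewrite map_mx1.
rewrite IH map_mxM /=; congr (_ *m _).
by case: x; case: e => //=; rewrite /letter_mx /double_mx /=;
  apply: mx2P; rewrite !mxE /= ?rmorphN.
Qed.

(** The action of [T = diag(1, y)]. *)
Definition stretch v : S * S := (v.1, 'X * v.2).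

(** Each letter satisfies [twist M T = y T M], which yields one power of [y] per letter. *)
Lemma word_mx_emb2 w v :
  app (word_mx double_mx (rename emb2 w)) (stretch v) =
  scale2 'X^(size w) (stretch (app (map_mx polyC (word_mx m w)) v)).
Proof.
elim: w => [|[x e] w IH].
  by rewrite /= map_mx1 !app1 /scale2 /= !mul1r.
rewrite [word_mx _ (rename _ _)]/= [word_mx m _]/= map_mxM !app_mul IH.
rewrite app_scale; set u := app _ v; rewrite [size _]/= exprSr.
have -> : letter_mx double_mx (emb2 x, e) = twist (letter_mx m (x, e)).
  by case: x; case: e => //; rewrite /letter_mx /double_mx /=;
    apply: mx2P; rewrite !mxE /= ?rmorphN ?mulrN.
by rewrite /stretch /scale2 /app /= !mxE /=; congr pair; ring.
Qed.

Lemma size_polyCM_leq (c : D) (q : S) : (size (c%:P * q)%R <= size q)%N.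
Proof. by rewrite mul_polyC size_scale_leq. Qed.

(** The matrix is constant in [y], and its nonzero upper right entry carries the leading term of the
    dominant [q.2] to the first coordinate. *)
Lemma emb1_degree w q : word_mx m w 0 1 != 0 ->
    (size q.1 < size q.2)%N ->
  let u := app (word_mx double_mx (rename emb1 w)) q in
  u.1 != 0 /\ (size u.2 <= size u.1)%N.
Proof.
move=> w01 q12 /=; rewrite word_mx_emb1 /= !mxE.
have e : size ((word_mx m w 0 0)%:P * q.1 + (word_mx m w 0 1)%:P * q.2) =
    size q.2.
  have e2 := size_Cmul q.2 w01; rewrite addrC size_polyDl e2 //.
  exact: leq_ltn_trans (size_polyCM_leq _ _) q12.
rewrite -size_poly_gt0 e; split; first exact: leq_ltn_trans q12.
rewrite (leq_trans (size_polyD _ _)) // geq_max.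
rewrite !(leq_trans (size_polyCM_leq _ _)) //; exact: ltnW.
Qed.

(** In the coordinates of [T^-1] the first entry dominates strictly; the nonzero lower left entry
    carries it to the second coordinate, which [T] then multiplies by [y]. *)
Lemma emb2_degree w q : word_mx m w 1 0 != 0 ->
    q.1 != 0 -> (size q.2 <= size q.1)%N ->
  let u := app (word_mx double_mx (rename emb2 w)) q in
  (size u.1 < size u.2)%N.
Proof.
move=> w10 q1 q21 /=; set N := word_mx _ _.
have X0 : 'X != 0 :> S by rewrite polyX_eq0.
(* The vector [T^-1 q], multiplied by [y] to stay polynomial. *)
have := word_mx_emb2 w ('X * q.1, q.2).
rewrite -[stretch _]/(scale2 'X q) -/N app_scale /scale2 /stretch.
case uE: (app _ ('X * q.1, q.2)) => [u1 u2] /= -[e1 e2].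
have q1X : size ('X * q.1) = (size q.1).+1 by rewrite mulrC size_mulX.
case: uE; rewrite !mxE /= => u1E u2E.
have u2q : size u2 = (size q.1).+1.
  have e3 := size_Cmul ('X * q.1) w10; rewrite -u2E size_polyDl e3 q1X //.
  by rewrite ltnS (leq_trans (size_polyCM_leq _ _)).
have u20 : u2 != 0 by rewrite -size_poly_gt0 u2q.
rewrite -(size_mul_ltn _ _ X0) e1 e2 size_mul_ltn ?expf_neq0 //.
rewrite ['X * _]mulrC size_mulX // u2q ltnS -u1E.
rewrite (leq_trans (size_polyD _ _)) // geq_max.
rewrite !(leq_trans (size_polyCM_leq _ _)) ?q1X //; exact: leq_trans q21 _.
Qed.

Hypothesis m_letter : forall s, letter_mx m s 1 0 != 0.
(** A vanishing off-diagonal entry puts the element in the amalgamated subgroup, where a word may be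
    rewritten from one factor to the other. *)
Hypothesis m_stab : forall w,
  word_mx m w 1 0 = 0 \/ word_mx m w 0 1 = 0 ->
  pres_eq S2_rels (rename emb1 w) (rename emb2 w).

(** Each syllable is required to have nonzero only the entry that the degree estimate for its factor
    uses. The final [g] is arbitrary, possibly empty. *)
Inductive alternating : word 'I_4 -> Prop :=
| alt_last h g : word_mx m h 1 0 != 0 ->
    alternating (rename emb2 h ++ rename emb1 g)
| alt_cons h g u : word_mx m h 1 0 != 0 -> word_mx m g 0 1 != 0 ->
    alternating u -> alternating (rename emb2 h ++ rename emb1 g ++ u).

(** This allows a leading factor from [<a, b>] to be moved to the end by conjugation. *)
Lemma alternating_cat u g : alternating u -> alternating (u ++ rename emb1 g).
Proof.
elim=> [h g' h10|h g' {}u h10 g01 _ IH]; rewrite -!catA.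
  by rewrite /rename -map_cat; apply: alt_last.
exact: alt_cons.
Qed.

(** Letters are added on the left one by one. A letter of [<a, b>] joins the leading factor; a
    letter of [<d, c>] opens a new syllable, unless the leading factor lies in the amalgamated
    subgroup and lets it merge. *)
Lemma normal_form w :
  (exists g, pres_eq S2_rels w (rename emb1 g)) \/
  (exists g u, alternating u /\ pres_eq S2_rels w (rename emb1 g ++ u)).
Proof.
elim: w => [|s w IH]; first by left; exists [::]; apply: pres_refl.
have [t [tE|tE]] : exists t, s = (emb1 t.1, t.2) \/ s = (emb2 t.1, t.2).
  case: s => -[[|[|[|[|//]]]] i4] e.
  - by exists (true, e); left; congr pair; apply: val_inj.
  - by exists (false, e); left; congr pair; apply: val_inj.
  - by exists (false, e); right; congr pair; apply: val_inj.
  - by exists (true, e); right; congr pair; apply: val_inj.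
- case: IH => [[g wg]|[g [u [au wgu]]]]; [left | right; exists (t :: g), u].
    by exists (t :: g); rewrite /= -tE; apply: (pres_eq_catl [:: s]).
  by split=> //; rewrite /= -tE; apply: (pres_eq_catl [:: s]).
case: IH => [[g wg]|[g [u [au wgu]]]].
  right; exists [::], (rename emb2 [:: t] ++ rename emb1 g); split.
    by apply: alt_last; rewrite /= mulmx1; case: (t) (m_letter t).
  by rewrite /= -tE; apply: (pres_eq_catl [:: s]).
have [g01|g01] := eqVneq (word_mx m g 0 1) 0; last first.
  right; exists [::], (rename emb2 [:: t] ++ rename emb1 g ++ u); split.
    by apply: alt_cons => //; rewrite /= mulmx1; case: (t) (m_letter t).
  by rewrite /= -tE; apply: (pres_eq_catl [:: s]).
have g12 : pres_eq S2_rels (rename emb1 g) (rename emb2 g).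
  by apply: m_stab; right.
have {}wgu : pres_eq S2_rels (s :: w) (rename emb2 (t :: g) ++ u).
  rewrite /= -tE; apply: (pres_eq_catl [:: s]).
  exact: pres_trans wgu (pres_eq_catr _ g12).
have cat2 h r : rename emb2 (t :: g) ++ rename emb2 h ++ r =
    rename emb2 (t :: g ++ h) ++ r.
  by rewrite catA /rename -map_cat.
have [h [r [uE ar]]] : exists h r, u = rename emb2 h ++ r /\
    (word_mx m (t :: g ++ h) 1 0 != 0 ->
       alternating (rename emb2 (t :: g ++ h) ++ r)) /\
    ((exists g', r = rename emb1 g') \/
     exists g' u', r = rename emb1 g' ++ u' /\ alternating u').
  case: au => [h g' h10|h g' u' h10 g'01 au'].
    exists h, (rename emb1 g'); split=> //; split; last by left; exists g'.
    exact: alt_last.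
  exists h, (rename emb1 g' ++ u'); split=> //; split; last first.
    by right; exists g', u'.
  by move=> th10; apply: alt_cons.
move: wgu; rewrite uE cat2 => wgu; case: ar => ar rE.
(* The merged syllable may itself fall into the amalgamated subgroup; it is then rewritten in
   [<a, b>] and absorbs the next syllable. *)
have [th10|/ar ath] := eqVneq (word_mx m (t :: g ++ h) 1 0) 0; last first.
  by right; exists [::], (rename emb2 (t :: g ++ h) ++ r).
have {}wgu := pres_trans wgu
  (pres_eq_catr r (pres_sym (m_stab (or_introl th10)))).
case: rE => [[g' rE]|[g' [u' [rE au']]]].
  by left; exists ((t :: g ++ h) ++ g'); move: wgu; rewrite rE /rename -map_cat.
right; exists ((t :: g ++ h) ++ g'), u'; split=> //.
by move: wgu; rewrite rE catA /rename -map_cat.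
Qed.

Lemma alternating_degree u : alternating u -> exists2 v : D * D, v.1 != 0 &
  let q := app (word_mx double_mx u) (v.1%:P, v.2%:P) in
  (size q.1 < size q.2)%N.
Proof.
elim=> [h g h10|h g {}u h10 g01 _ [v v10 IH]]; last first.
  exists v => //; rewrite !word_mx_cat !app_mul.
  by have [??] := emb1_degree g01 IH; apply: emb2_degree.
(* A constant vector whose first coordinate is nonzero both before and after [g]. If the corner
   entry of [g] vanishes, its upper right entry does not, by the determinant. *)
have [v [v10 gv]] : exists v : D * D, v.1 != 0 /\ (app (word_mx m g) v).1 != 0.
  have [g00|g00] := eqVneq (word_mx m g 0 0) 0.
    exists (1, 1); rewrite /app oner_neq0 !mulr1 g00 add0r; split=> //.
    by have := word_mx_det m_det g; rewrite det_mx2 g00 mul0r add0r oppr_eq0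
      mulf_eq0 negb_or => /andP[].
  by exists (1, 0); rewrite /app oner_neq0 mulr1 mulr0 addr0.
exists v => //; rewrite word_mx_cat app_mul; apply: emb2_degree => //.
  rewrite word_mx_emb1 /app /= !mxE -!rmorphM -rmorphD polyC_eq0; exact: gv.
rewrite word_mx_emb1 /app /= !mxE -!rmorphM -!rmorphD !size_polyC gv.
by case: (_ != 0).
Qed.

(** A scalar multiple of a constant vector with nonzero first coordinate cannot have a second
    coordinate of larger degree. *)
Lemma alternating_not_scalar u (c : S) :
  alternating u -> word_mx double_mx u <> c%:M.
Proof.
move=> /alternating_degree[v v10] + uc.
have [->|c0] := eqVneq v.2 0; rewrite uc -scalemx1 appZ app1 /=.
  by rewrite mulr0 size_poly0.
by rewrite ![c * _]mulrC !size_Cmul // ltnn.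
Qed.

End Double.

(** * The representation *)

Section Specialization.
Variables (F : fieldType) (K : fieldType).
Hypothesis two_neq0 : (2 : F) != 0.
Variable iota : {rmorphism {poly {poly F}} -> K}.
Hypothesis iota_inj : injective iota.
Local Notation x := (iota 'X%:P).
Local Notation y := (iota 'X).

(* The matrices of the theorem, over an abstract field: in [Fpxy p] itself,
   conversion unfolds fractions. *)
Definition genA : 'M[K]_2 := mx2
  ((1 - 2 * x ^+ 2 - 2 * x ^+ 3) / (x * (x - 1)))
  ((1 - 2 * x ^+ 2 - x ^+ 3 - x ^+ 4) / (x ^+ 3 * (x - 1)))
  1
  (1 / x ^+ 2).

Definition genB : 'M[K]_2 := mx2
  ((x ^+ 2 - 1) / (x - 2 * x ^+ 3 - 2 * x ^+ 4))
  ((1 + 2 * x - x ^+ 2 - 3 * x ^+ 3 - 2 * x ^+ 4)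
     / (x ^+ 2 * (2 * x ^+ 3 + 2 * x ^+ 2 - 1)))
  x
  (1 + x).

Definition genD : 'M[K]_2 := mx2
  ((1 - 2 * x ^+ 2 - 2 * x ^+ 3) / (x * (x - 1)))
  ((1 - 2 * x ^+ 2 - x ^+ 3 - x ^+ 4) / (y * x ^+ 3 * (x - 1)))
  y
  (1 / x ^+ 2).

Definition genC : 'M[K]_2 := mx2
  ((x ^+ 2 - 1) / (x - 2 * x ^+ 3 - 2 * x ^+ 4))
  ((1 + 2 * x - x ^+ 2 - 3 * x ^+ 3 - 2 * x ^+ 4)
     / (y * x ^+ 2 * (2 * x ^+ 3 + 2 * x ^+ 2 - 1)))
  (y * x)
  (1 + x).

Let rmE := (rmorphM, rmorphB, rmorphD, rmorphXn, rmorph1, rmorph_nat, rmorphN).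

Let iota_neq0 q : q != 0 -> iota q != 0.
Proof. by rewrite -(rmorph0 iota) (inj_eq iota_inj). Qed.

Let iotaC_neq0 (q : {poly F}) : q != 0 -> iota q%:P != 0.
Proof. by move=> q0; rewrite iota_neq0 // polyC_eq0. Qed.

Let x_neq0 : x != 0.
Proof. exact/iotaC_neq0/polyX_neq0. Qed.

Let y_neq0 : y != 0.
Proof. by rewrite iota_neq0 ?polyX_eq0. Qed.

Let x1_neq0 : x - 1 != 0.
Proof. by have := iotaC_neq0 (polyX_subr1_neq0 F); rewrite !rmE. Qed.

Let pole1_neq0 : 2 * x ^+ 3 + 2 * x ^+ 2 - 1 != 0.
Proof. by have := iotaC_neq0 (pole_neq0 two_neq0); rewrite !rmE. Qed.

Let pole2_neq0 : 1 - 2 * x ^+ 2 - 2 * x ^+ 3 != 0.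
Proof.
have -> : 1 - 2 * x ^+ 2 - 2 * x ^+ 3 = - (2 * x ^+ 3 + 2 * x ^+ 2 - 1) by ring.
by rewrite oppr_eq0.
Qed.

Let pole3_neq0 : x - 2 * x ^+ 3 - 2 * x ^+ 4 != 0.
Proof.
have -> : x - 2 * x ^+ 3 - 2 * x ^+ 4 = x * (1 - 2 * x ^+ 2 - 2 * x ^+ 3).
  by ring.
by rewrite mulf_neq0.
Qed.

Let neq0E := (x_neq0, y_neq0, x1_neq0, pole1_neq0, pole2_neq0, pole3_neq0).

Lemma det_genA : \det genA == 1.
Proof. by rewrite det_mx2 !mxE /=; apply/eqP; field; rewrite ?neq0E. Qed.

Lemma det_genB : \det genB == 1.
Proof. by rewrite det_mx2 !mxE /=; apply/eqP; field; rewrite ?neq0E. Qed.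

Lemma det_genC : \det genC == 1.
Proof. by rewrite det_mx2 !mxE /=; apply/eqP; field; rewrite ?neq0E. Qed.

Lemma det_genD : \det genD == 1.
Proof. by rewrite det_mx2 !mxE /=; apply/eqP; field; rewrite ?neq0E. Qed.

(** The common value of both commutators; the diagonal entry [l] is its eigenvalue at the end
    infinity. *)
Definition axis : 'M[K]_2 :=
  let l := x * (1 - 2 * x ^+ 2 - 2 * x ^+ 3) / (x - 1) in mx2 l 0 0 l^-1.

Lemma genAB : genA *m genB = axis *m genB *m genA.
Proof.
by apply: mx2P; rewrite !mulmx2E !mxE /=; field; rewrite ?neq0E.
Qed.

Lemma genDC : genD *m genC = axis *m genC *m genD.
Proof.
by apply: mx2P; rewrite !mulmx2E !mxE /=; field; rewrite ?neq0E.
Qed.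

Definition genSL (i : 'I_4) : SL 2 K :=
  match val i with
  | 0 => MkSL det_genA
  | 1 => MkSL det_genB
  | 2 => MkSL det_genC
  | _ => MkSL det_genD
  end.

Local Notation m4 := (double_mx (mxAB F)).

Lemma genSL_scaled i :
  exists2 s, s != 0 & s *: slval (genSL i) = map_mx iota (m4 i).
Proof.
pose sA := x ^+ 3 * (x - 1); pose sB := x ^+ 2 * (2 * x ^+ 3 + 2 * x ^+ 2 - 1).
have sA0 : sA != 0 by rewrite !(mulf_neq0, expf_neq0) ?neq0E.
have sB0 : sB != 0 by rewrite !(mulf_neq0, expf_neq0) ?neq0E.
case: i => -[|[|[|[|//]]]] ?; rewrite /genSL /double_mx /=.
- exists sA => //; rewrite /sA.
  by apply: mx2P; rewrite !mxE /=; field; rewrite ?neq0E.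
- exists sB => //; rewrite /sB.
  by apply: mx2P; rewrite !mxE /=; field; rewrite ?neq0E.
(* The additional [y] matches the one built into [twist]. *)
- exists (y * sB); first by rewrite mulf_neq0.
  rewrite /sB.
  by apply: mx2P; rewrite !mxE /=; field; rewrite ?neq0E.
- exists (y * sA); first by rewrite mulf_neq0.
  rewrite /sA.
  by apply: mx2P; rewrite !mxE /=; field; rewrite ?neq0E.
Qed.

Lemma slval_inv (M : SL 2 K) : slval M^-1%g = adj2 M.
Proof.
have := mul_adj2 M; rewrite det_SL => e.
by rewrite -[RHS]mul1mx -(mulVmx (SL_unitmx M)) -mulmxA e mulmx1.
Qed.

Lemma slvalM (M N : SL 2 K) : slval (M * N)%g = slval M *m slval N.
Proof. by []. Qed.

Lemma word_eval_scaled w : exists2 s, s != 0 &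
  s *: slval (word_eval genSL w) = map_mx iota (word_mx m4 w).
Proof.
elim: w => [|[i e] w [s s0 IH]].
  by exists 1; rewrite ?oner_neq0 //= scale1r map_mx1.
have [r r0 rE] := genSL_scaled i; exists (r * s); first by rewrite mulf_neq0.
rewrite [word_mx _ _]/= map_mxM -IH slvalM -scalemxAr mulrC -scalerA.
congr (_ *: _); rewrite scalemxAl; congr (_ *m _); rewrite /letter_mx /=.
case: e => //; rewrite slval_inv.
have -> : map_mx iota (adj2 (m4 i)) = adj2 (map_mx iota (m4 i)).
  by apply: mx2P; rewrite !mxE /= ?rmorphN.
by rewrite -rE; apply: mx2P; rewrite !mxE /= ?mulrN.
Qed.

Lemma word_eval_eq1 w :
  word_eval genSL w = 1%g -> word_mx m4 w = (word_mx m4 w 0 0)%:M.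
Proof.
have [s s0 sE] := word_eval_scaled w => w1.
have {}sE i j : s * (i == j)%:R = iota (word_mx m4 w i j).
  by have /matrixP/(_ i j) := sE; rewrite w1 !mxE.
apply: mx2P; rewrite !mxE ?mulr1n ?mulr0n //; apply: iota_inj;
  by rewrite -!sE ?rmorph0 ?mulr0.
Qed.

Lemma genSL_stab w :
    word_mx (mxAB F) w 1 0 = 0 \/ word_mx (mxAB F) w 0 1 = 0 ->
  pres_eq S2_rels (rename emb1 w) (rename emb2 w).
Proof.
(* The predicate for the stabilizer lemmas: both copies of a word agree in [S_2]. The defining
   relation gives it for the commutator. *)
pose Z u := pres_eq S2_rels (rename emb1 u) (rename emb2 u).
have Z_eq u v : pres_eq [::] u v -> Z u -> Z v.
  move=> uv Zu; apply: pres_trans (pres_sym (pres_eq_rename _ emb1 uv)) _.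
  exact: pres_trans Zu (pres_eq_rename _ emb2 uv).
have Z_cat u v : Z u -> Z v -> Z (u ++ v).
  by move=> Zu Zv; rewrite /Z /rename !map_cat; apply: pres_eq_cat Zu Zv.
have Z_inv u : Z u -> Z (inv_word u).
  by rewrite /Z !rename_inv; apply: pres_eq_inv.
have Z_comm :
  Z [:: (true, true); (false, true); (true, false); (false, false)].
  exact: (@pres_rel _ S2_rels [::] _ _ [::] (mem_head _ _)).
have [r [rr wr [d d0 wE]]] := reduced_form (mxAB_det two_neq0) w.
rewrite wE !mxE => h; apply: (Z_eq _ _ (pres_sym wr)).
case: h => /eqP; rewrite mulf_eq0 (negPf d0) => /eqP.
- exact: (fix_infty two_neq0 Z_eq Z_cat Z_inv Z_comm rr).
- exact: (fix_zero two_neq0 Z_eq Z_cat Z_inv Z_comm rr).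
Qed.

(** [A] and [B] generate a free group even modulo scalars. *)
Lemma mxAB_scalar w c :
  word_mx (mxAB F) w = c%:M -> pres_eq [::] w [::].
Proof.
move=> wc; have [r [rr wr [d d0 wE]]] := reduced_form (mxAB_det two_neq0) w.
suff r0 : r = [::] by move: wr; rewrite r0.
apply: (reduced_scalar two_neq0 (c := word_mx (mxAB F) r 0 0)) => //.
have dE i j : d * word_mx (mxAB F) r i j = c *+ (i == j).
  by have /matrixP/(_ i j) := wc; rewrite wE !mxE.
by apply: mx2P; rewrite [RHS]mxE ?mulr1n ?mulr0n //; apply: (mulfI d0);
  rewrite !dE ?mulr0.
Qed.

Lemma det_axis : \det axis == 1.
Proof. by rewrite det_mx2 !mxE /=; apply/eqP; field; rewrite ?neq0E. Qed.

Lemma genSL_comm :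
  (genSL gen_a * genSL gen_b * (genSL gen_a)^-1 * (genSL gen_b)^-1 =
   genSL gen_d * genSL gen_c * (genSL gen_d)^-1 * (genSL gen_c)^-1)%g.
Proof.
have ab : (genSL gen_a * genSL gen_b =
    MkSL det_axis * genSL gen_b * genSL gen_a)%g.
  by apply: val_inj; apply: genAB.
have dc : (genSL gen_d * genSL gen_c =
    MkSL det_axis * genSL gen_c * genSL gen_d)%g.
  by apply: val_inj; apply: genDC.
by rewrite ab dc !mulgK.
Qed.

Lemma genSL_rels :
  {in S2_rels, forall r, word_eval genSL r.1 = word_eval genSL r.2}.
Proof.
move=> r; rewrite inE => /eqP-> /=; rewrite !mulg1 !mulgA.
exact: genSL_comm.
Qed.

Lemma genSL_faithful w : word_eval genSL w = 1%g -> pres_eq S2_rels w [::].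
Proof.
move=> w1; have [[g wg]|[g [u [au wgu]]]] :=
  normal_form (letter_offdiag two_neq0) genSL_stab w.
  apply: (pres_trans wg); apply: (@pres_eq_rename _ _ _ _ g [::]).
  have := word_eval_eq1 (etrans (esym (word_eval_pres genSL_rels wg)) w1).
  rewrite word_mx_emb1 => /matrixP wE.
  apply: (@mxAB_scalar _ (word_mx (mxAB F) g 0 0)); apply: mx2P;
    rewrite !mxE ?mulr1n ?mulr0n //; apply: polyC_inj.
  - by have := wE 0 1; rewrite !mxE mulr0n.
  - by have := wE 1 0; rewrite !mxE mulr0n.
  - by have := wE 1 1; rewrite !mxE mulr1n.
(* If the product of [g] and [u] is trivial, so is that of [u] and [g], which is alternating. *)
exfalso; apply: (alternating_not_scalar (mxAB_det two_neq0)
  (alternating_cat g au)).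
apply: word_eval_eq1; rewrite word_eval_cat.
have := word_eval_pres genSL_rels wgu; rewrite w1 word_eval_cat => /esym e.
rewrite -[word_eval genSL u](mulKg (word_eval genSL (rename emb1 g))) e.
by rewrite mulg1 mulVg.
Qed.

End Specialization.

Lemma tofrac_inj (D : idomainType) : injective (@FracField.tofrac D).
Proof. by move=> a b /eqP; rewrite tofrac_eq => /eqP. Qed.

Theorem theorem5p4 (p : nat) (p_prime : prime p) (p_odd : odd p) :
  exists A B C D : SL 2 (Fpxy p),
    [/\ slval A = matA p, slval B = matB p,
        slval C = matC p & slval D = matD p] /\
    (A * B * A^-1 * B^-1 = D * C * D^-1 * C^-1)%g /\
    exists rho : {multiplicative S2 -> SL 2 (Fpxy p)},
      [/\ rho (pres_gen S2_rels gen_a) = A,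
          rho (pres_gen S2_rels gen_b) = B,
          rho (pres_gen S2_rels gen_c) = C,
          rho (pres_gen S2_rels gen_d) = D
        & injective rho].
Proof.
have two_neq0 : (2 : 'F_p) != 0.
  rewrite -(dvdn_pcharf (pchar_Fp p_prime)) dvdn_prime2 //.
  by apply: contraTneq p_odd => ->.
have inj := @tofrac_inj {poly {poly 'F_p}}.
pose G := genSL two_neq0 inj.
exists (G gen_a), (G gen_b), (G gen_c), (G gen_d); split; first by [].
split; first exact: genSL_comm.
have [rho rhoE] := pres_lift (genSL_rels two_neq0 inj).
have rho_gen i : rho (pres_gen S2_rels i) = G i.
  by rewrite rhoE /= mulg1.
exists rho; split=> // g h gh; apply/divg1_eq.
have : rho (g / h)%g = 1%g.
  by apply: (@mulIg _ (rho h)); rewrite -gmulfM divgK mul1g.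
rewrite -(pres_reprK (g / h)%g) rhoE => /genSL_faithful gh1.
exact/pres_classP.
Qed.
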